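(* For any $n\in\mathbb{N}$, let $Z_n$ be a centered real-valued random variable with variance one and existing absolute moments, which satisfies $$|\Gamma_j(Z_n)|\le \frac{C_{j,\gamma}}{\Delta_n^{j-2}}\qquad\text{for all } j=3,4,\dots$$ for a constant $C_{j,\gamma}$ depending on $j$ and a fixed $\gamma\ge 0$, and $\Delta_n>0$. Put $C_{2,\gamma}:=1$ and let $N$ denote a standard normally distributed random variable. Then: (a) For any $k=3,4,\dots$, $$\bigl|\mathbb{E}(Z_n^k)-\mathbb{E}(N^k)\bigr|\le \sum_{1\le j\le \lceil \frac k2-1\rceil} A_{j,k}\,\frac{1}{\Delta_n^{k-2j}},\qquad A_{j,k}:=\frac1{j!}\sum_{\substack{k_1+\cdots+k_j=k\\ k_i\ge 2}} C_{k_1,\gamma}\cdots C_{k_j,\gamma}\,\frac{k!}{k_1!\cdots k_j!}.$$ (b) For an even $k=2l$ (with $k\ge 3$), assuming that $\Delta_n\to\infty$, $$\bigl|\mathbb{E}(Z_n^{k})-\mathbb{E}(N^{k})\bigr|\le C_1(k,\gamma)\,\frac1{\Delta_n^2}$$ with a constant $C_1(k,\gamma)$ only depending on $k$ and $\gamma$. (c) For an odd $k=2l+1$ (with $k\ge 3$), assuming that $\Delta_n\to\infty$, $$\bigl|\mathbb{E}(Z_n^{k})\bigr|\le C_2(k,\gamma)\,\frac1{\Delta_n}$$ with a constant $C_2(k,\gamma)$ only depending on $k$ and $\gamma$.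
   Context: For a real-valued random variable $X$ with existing absolute moments, the $j$-th cumulant is $\Gamma_j(X):=(-i)^j\frac{d^j}{dt^j}\log\mathbb{E}[e^{itX}]\big|_{t=0}$, $j\in\mathbb{N}$. $\lceil\cdot\rceil$ denotes the ceiling function, so $\lceil \frac k2-1\rceil=\frac k2-1$ if $k$ is even and $\frac k2-\frac12$ if $k$ is odd. The sum defining $A_{j,k}$ runs over $j$-tuples $(k_1,\dots,k_j)$ of integers $k_i\ge 2$ with sum $k$.
   Formalization: In (b) and (c) the bound with a constant depending only on k and γ (and the C_{j,γ}) is proved for all sufficiently large n; for every n it is proved with a constant that may also depend on the sequence Δ_n, since one uniform constant for every n is impossible. *)

(* Defs.v *)
From HB Require Import structures.
From mathcomp Require Export all_boot all_order all_algebra.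
From mathcomp Require Export complex.
From mathcomp Require Export all_classical all_reals all_analysis.

Set Implicit Arguments.
Unset Strict Implicit.
Unset Printing Implicit Defensive.
Export Order.TTheory GRing.Theory Num.Theory.
Export numFieldNormedType.Exports.

Local Open Scope classical_set_scope.
Local Open Scope ring_scope.

Section ComplexFunctions.
Context {R : realType}.
Implicit Types z : R[i].

Definition cexp z : R[i] :=
  (expR (complex.Re z) * cos (complex.Im z)
   +i* (expR (complex.Re z) * sin (complex.Im z)))%C.

(* Principal argument, in ]-pi, pi]: off the closed negative real axis it is
   given by the half-angle formula tan (arg z / 2) = Im z / (|z| + Re z). *)
Definition carg z : R :=
  if (complex.Re z < 0) && (complex.Im z == 0) then pi
  else 2 * atan (complex.Im z / (Normc.normc z + complex.Re z)).

Definition clog z : R[i] := (ln (Normc.normc z) +i* carg z)%C.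

(* The derivative of a complex-valued function of a real variable is taken
   componentwise. *)
Definition cderive1n (j : nat) (f : R -> R[i]) (t : R) : R[i] :=
  (derive1n j (fun s => complex.Re (f s) : R^o) t
   +i* derive1n j (fun s => complex.Im (f s) : R^o) t)%C.

End ComplexFunctions.

Section Cumulants.
Context {d : measure_display} {T : measurableType d} {R : realType}.
Variable P : probability T R.

Definition cexpectation (F : T -> R[i]) : R[i] :=
  (fine 'E_P[fun w => complex.Re (F w)]%E
   +i* fine 'E_P[fun w => complex.Im (F w)]%E)%C.

Definition charfun (X : T -> R) (t : R) : R[i] :=
  cexpectation (fun w => cexp ('i%C * (t%:C)%C * ((X w)%:C)%C)).

(* [charfun X] is 1 at 0, so near 0 the principal branch [clog] is the branch
   of the logarithm that vanishes at t = 0. *)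
Definition cumulant (X : T -> R) (j : nat) : R[i] :=
  (- 'i%C) ^+ j * cderive1n j (fun t => clog (charfun X t)) 0.

Definition has_abs_moments (X : T -> R) : Prop :=
  forall k : nat, ('E_P[fun w => (`|X w| ^+ k)%R] < +oo)%E.

Definition standard_normal (X : {RV P >-> R}) : Prop :=
  forall A : set R, measurable A -> distribution P X A = normal_prob 0 1 A.

End Cumulants.

Section Coefficients.
Context {R : realType}.
Variables (C : nat -> R -> R) (gamma : R).

Definition cumC (j : nat) : R := if j == 2%N then 1 else C j gamma.

(* All parts of a j-tuple of naturals with sum k are at most k, so the tuples
   can be taken in 'I_k.+1. *)
Definition coefA (j k : nat) : R :=
  (j`!%:R)^-1 *
  \sum_(f : {ffun 'I_j -> 'I_k.+1} |
          (\sum_i (f i : nat) == k)%N && [forall i, (2 <= f i)%N])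
     (\prod_i cumC (f i)) * (k`!%:R / \prod_i ((f i)`!)%:R).

End Coefficients.

(* Main.v *)
From HB Require Import structures.
Require Import Defs.
From mathcomp Require Import measurable_realfun ring lra zify.

(* The characteristic function of a variable with all moments is smooth, with
   n-th derivative E[(iX)^n exp(itX)].  Applying the Leibniz rule to f' = f * L',
   L = log f, at 0 gives the recursion
     m_(n+1) = sum_(i <= n) C(n,i) m_(n-i) Gamma_(i+1),
   that is, the exponential generating series of the moments is the exponential
   of that of the cumulants.  Expanding the exponential writes m_k as a sum over
   tuples (k_1, ..., k_j) with sum k, where only parts >= 2 contribute because
   Gamma_1 = 0.  The moments of the normal law obey the same expansion with
   Gamma_2 = 1 as the only nonzero cumulant; so in E Z^k - E N^k the tuples
   (2, ..., 2) cancel, and those that remain have j < k/2 parts.  The normal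
   moments come from differentiating E[exp(tN)] = exp(t^2/2). *)

Set Implicit Arguments.
Unset Strict Implicit.
Unset Printing Implicit Defensive.

Local Open Scope classical_set_scope.
Local Open Scope ring_scope.

(** * Differentiation under the integral sign *)

Lemma is_derive_Rintegral d (T : measurableType d) (R : realType)
    (mu : {measure set T -> \bar R}) (h h' : R -> T -> R) (G : T -> R) (u v a : R) :
  u < a < v ->
  (forall t, u < t < v -> mu.-integrable setT (EFin \o h t)) ->
  (forall t w, u < t < v -> is_derive t 1 (h^~ w) (h' t w)) ->
  (forall t w, u < t < v -> `|h' t w| <= G w) ->
  mu.-integrable setT (EFin \o G) ->
  is_derive a 1 (fun t => \int[mu]_w h t w) (\int[mu]_w h' a w).
Proof.
move=> auv hint hder hG Gint.
have d1 t w : u < t < v -> partial1of2 h t w = h' t w.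
  by move=> /(hder t w) ?; rewrite partial1of2E derive_val.
have Ia : `]u, v[%classic a by rewrite /= in_itv.
have G0 w : 0 <= G w by apply: le_trans (hG a w auv).
have int' t : `]u, v[%classic t -> mu.-integrable setT (EFin \o h t).
  by rewrite /= in_itv => /hint.
have der' t w : `]u, v[%classic t -> setT w -> derivable (h ^~ w) t 1.
  by rewrite /= in_itv => /(hder t w)[].
have ub' t w : `]u, v[%classic t -> setT w -> `|partial1of2 h t w| <= G w.
  by rewrite /= in_itv => /= tuv _; rewrite d1 // hG.
apply: DeriveDef.
  exact: (derivable_under_integral measurableT Ia int' der' G0 Gint ub').
rewrite -derive1E.
rewrite (differentiation_under_integral measurableT Ia int' der' G0 Gint ub').
by apply: eq_Rintegral => w _; rewrite d1.
Qed.

(** * Calculus of complex-valued functions of a real variable *)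

Section complex_derivative.
Context {R : realType}.
Implicit Types (f g : R -> R[i]) (t : R) (l m : R[i]).

(** Componentwise, to match [cderive1n]: each component is then open to the calculus of real
    derivatives. *)
Definition is_cderive t f l :=
  is_derive t 1 (fun s => complex.Re (f s) : R^o) (complex.Re l) /\
  is_derive t 1 (fun s => complex.Im (f s) : R^o) (complex.Im l).

Lemma is_cderive_cst t c : is_cderive t (fun=> c) 0.
Proof. by split; exact: is_derive_cst. Qed.

Lemma is_cderiveD t f g l m : is_cderive t f l -> is_cderive t g m ->
  is_cderive t (fun s => f s + g s) (l + m).
Proof.
move=> [fr fi] [gr gi]; split.
- rewrite (_ : (fun s => _) = (fun s => complex.Re (f s)) + (fun s => complex.Re (g s))).
    by rewrite raddfD; exact: is_deriveD.
  by apply/funext => s; rewrite fctE raddfD.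
- rewrite (_ : (fun s => _) = (fun s => complex.Im (f s)) + (fun s => complex.Im (g s))).
    by rewrite raddfD; exact: is_deriveD.
  by apply/funext => s; rewrite fctE raddfD.
Qed.

Lemma ReD (x y : R[i]) : complex.Re (x + y) = complex.Re x + complex.Re y.
Proof. by case: x y => [a b] [c d]. Qed.

Lemma ImD (x y : R[i]) : complex.Im (x + y) = complex.Im x + complex.Im y.
Proof. by case: x y => [a b] [c d]. Qed.

Lemma ReM (x y : R[i]) : complex.Re (x * y) =
  complex.Re x * complex.Re y - complex.Im x * complex.Im y.
Proof. by case: x y => [a b] [c d]. Qed.

Lemma ImM (x y : R[i]) : complex.Im (x * y) =
  complex.Re x * complex.Im y + complex.Im x * complex.Re y.
Proof. by case: x y => [a b] [c d]. Qed.

Lemma is_cderiveM t f g l m : is_cderive t f l -> is_cderive t g m ->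
  is_cderive t (fun s => f s * g s) (l * g t + f t * m).
Proof.
move=> [fr fi] [gr gi]; split.
- rewrite (_ : (fun s => _) = (fun s => complex.Re (f s)) * (fun s => complex.Re (g s)) -
     (fun s => complex.Im (f s)) * (fun s => complex.Im (g s))).
    apply: (is_derive_eq (is_deriveB (is_deriveM fr gr) (is_deriveM fi gi))).
    by rewrite ReD !ReM /GRing.scale /=; ring.
  by apply/funext => s; rewrite !fctE ReM.
- rewrite (_ : (fun s => _) = (fun s => complex.Re (f s)) * (fun s => complex.Im (g s)) +
     (fun s => complex.Im (f s)) * (fun s => complex.Re (g s))).
    apply: (is_derive_eq (is_deriveD (is_deriveM fr gi) (is_deriveM fi gr))).
    by rewrite ImD !ImM /GRing.scale /=; ring.
  by apply/funext => s; rewrite !fctE ImM.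
Qed.

Lemma is_cderiveZ t c f l : is_cderive t f l ->
  is_cderive t (fun s => c * f s) (c * l).
Proof.
by move=> fl; have := is_cderiveM (is_cderive_cst t c) fl; rewrite mul0r add0r.
Qed.

Lemma is_cderive_sum t n (f : nat -> R -> R[i]) (l : nat -> R[i]) :
  (forall i, (i < n)%N -> is_cderive t (f i) (l i)) ->
  is_cderive t (fun s => \sum_(i < n) f i s) (\sum_(i < n) l i).
Proof.
elim: n => [_|n IH fl].
  under eq_fun do rewrite big_ord0.
  by rewrite big_ord0; exact: is_cderive_cst.
under eq_fun do rewrite big_ord_recr /=.
rewrite big_ord_recr; apply: is_cderiveD; last exact: fl.
by apply: IH => i ni; apply: fl; exact: ltnW.
Qed.

Lemma is_cderive_unique t f l m : is_cderive t f l -> is_cderive t f m -> l = m.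
Proof.
case: l m => [a b] [c d] [[_ /= <-] [_ /= <-]] [[_ /= <-] [_ /= <-]] //.
Qed.

Lemma near_eq_is_cderive t f g l : (\forall s \near t, f s = g s) ->
  is_cderive t f l -> is_cderive t g l.
Proof.
move=> fg [fr fi]; split.
- apply: near_eq_is_derive fr.
  by near=> s; congr complex.Re; near: s.
- apply: near_eq_is_derive fi.
  by near=> s; congr complex.Im; near: s.
Unshelve. all: by end_near. Qed.

Lemma cexp_imE (t x : R) :
  cexp ('i%C * (t%:C)%C * (x%:C)%C) = (cos (x * t) +i* sin (x * t))%C.
Proof.
have -> : ('i%C * (t%:C)%C * (x%:C)%C) = (0 +i* (x * t))%C.
  by apply/eqP; rewrite eq_complex /=; apply/andP; split; apply/eqP; ring.
by rewrite /cexp /= expR0 !mul1r.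
Qed.

Lemma is_cderive_cexp t (x : R) :
  is_cderive t (fun s => cexp ('i%C * (s%:C)%C * (x%:C)%C))
    ('i%C * (x%:C)%C * cexp ('i%C * (t%:C)%C * (x%:C)%C)).
Proof.
have xt : is_derive t 1 ( *%R x : R -> R^o) x.
  by apply: is_derive_eq; rewrite [LHS]mulr1.
rewrite cexp_imE; split.
- under eq_fun do rewrite cexp_imE.
  apply: (is_derive_eq (is_derive1_comp (is_derive_cos _) xt)).
  by rewrite /=; ring.
- under eq_fun do rewrite cexp_imE.
  apply: (is_derive_eq (is_derive1_comp (is_derive_sin _) xt)).
  by rewrite /=; ring.
Qed.

End complex_derivative.

(** * Smoothness of the characteristic function *)

Section charfun_derivatives.
Context d (T : measurableType d) (R : realType) (P : probability T R).
Context (X : {RV P >-> R}) (hX : has_abs_moments P X).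

(** The n-th derivative of exp(itx) in t; differentiating only shifts the index n. *)
Definition charfun_integrand n (t x : R) : R[i] :=
  ('i%C * (x%:C)%C) ^+ n * cexp ('i%C * (t%:C)%C * (x%:C)%C).

Definition charfun_deriv n (t : R) : R[i] :=
  cexpectation P (fun w => charfun_integrand n t (X w)).

Lemma is_cderive_charfun_integrand n t x :
  is_cderive t (charfun_integrand n ^~ x) (charfun_integrand n.+1 t x).
Proof.
rewrite /charfun_integrand exprSr -mulrA.
exact: is_cderiveZ (is_cderive_cexp t x).
Qed.

(** Since exp(itx) has modulus one, the modulus is free of t. This is the source of the integrable
    majorant for differentiation under the integral. *)
Lemma normc_charfun_integrand n t x :
  Normc.normc (charfun_integrand n t x) = `|x| ^+ n.
Proof.
rewrite /charfun_integrand cexp_imE Normc.normcM [X in _ * X]/= cos2Dsin2.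
rewrite sqrtr1 mulr1; elim: n => [|n IH]; first by rewrite !expr0 Normc.normc1.
rewrite !exprS Normc.normcM IH; congr (_ * _).
rewrite (_ : 'i%C * (x%:C)%C = (0 +i* x)%C) /= ?expr0n /= ?add0r ?sqrtr_sqr //.
by apply/eqP; rewrite eq_complex /=; apply/andP; split; apply/eqP; ring.
Qed.

Lemma ReIm_charfun_integrand_le n t x :
  `|complex.Re (charfun_integrand n t x)| <= `|x| ^+ n /\
  `|complex.Im (charfun_integrand n t x)| <= `|x| ^+ n.
Proof.
rewrite -(normc_charfun_integrand n t); case: (charfun_integrand n t x) => a b /=.
rewrite -!sqrtr_sqr; split; rewrite ler_wsqrtr //.
  by rewrite lerDl sqr_ge0.
by rewrite lerDr sqr_ge0.
Qed.

Lemma measurable_charfun_integrand n t :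
  measurable_fun setT (fun w => complex.Re (charfun_integrand n t (X w))) /\
  measurable_fun setT (fun w => complex.Im (charfun_integrand n t (X w))).
Proof.
have mXn : measurable_fun setT (fun w => X w ^+ n) by exact: measurable_funX.
have mXt : measurable_fun setT (fun w => X w * t).
  by apply: measurable_funM => //; exact: measurable_cst.
have mc : measurable_fun setT (fun w => cos (X w * t)).
  apply: measurableT_comp mXt.
  by apply: continuous_measurable_fun; exact: continuous_cos.
have ms : measurable_fun setT (fun w => sin (X w * t)).
  apply: measurableT_comp mXt.
  by apply: continuous_measurable_fun; exact: continuous_sin.
(* Splitting off the constant i^n turns the real and imaginary parts into combinations of X^n
   cos(tX) and X^n sin(tX) with constant coefficients. *)
pose a : R[i] := 'i%C ^+ n.
have E x : charfun_integrand n t x =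
    a * ((x ^+ n)%:C)%C * (cos (x * t) +i* sin (x * t))%C.
  by rewrite /charfun_integrand cexp_imE exprMn -rmorphXn.
split.
- rewrite (_ : (fun w => _) = (fun w => complex.Re a * (X w ^+ n * cos (X w * t))
     - complex.Im a * (X w ^+ n * sin (X w * t)))).
    by apply: measurable_funB; apply: measurable_funM => //; exact: measurable_funM.
  by apply/funext => w; rewrite E -mulrA !(ReM, ImM) /=; ring.
- rewrite (_ : (fun w => _) = (fun w => complex.Re a * (X w ^+ n * sin (X w * t))
     + complex.Im a * (X w ^+ n * cos (X w * t)))).
    by apply: measurable_funD; apply: measurable_funM => //; exact: measurable_funM.
  by apply/funext => w; rewrite E -mulrA !(ReM, ImM) /=; ring.
Qed.

Lemma integrable_abs_moment n :
  P.-integrable setT (EFin \o (fun w => `|X w| ^+ n)).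
Proof.
apply/integrableP; split.
  by apply/measurable_EFinP; apply: measurable_funX; exact: measurableT_comp.
have := hX n; rewrite unlock; congr (_ < _)%E; apply: eq_integral => w _ /=.
by rewrite [in RHS]ger0_norm // exprn_ge0.
Qed.

Lemma integrable_moment n :
  P.-integrable setT (EFin \o (fun w => X w ^+ n)).
Proof.
apply: (le_integrable _ _ _ (integrable_abs_moment n)) => //.
  by apply/measurable_EFinP; exact: measurable_funX.
by move=> w _ /=; rewrite lee_fin !normrX normr_id.
Qed.

Lemma integrable_charfun_integrand n t :
  P.-integrable setT (EFin \o (fun w => complex.Re (charfun_integrand n t (X w)))) /\
  P.-integrable setT (EFin \o (fun w => complex.Im (charfun_integrand n t (X w)))).
Proof.
have [mr mi] := measurable_charfun_integrand n t.
have le w := ReIm_charfun_integrand_le n t (X w).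
split; apply: (le_integrable _ _ _ (integrable_abs_moment n)) => //.
- exact/measurable_EFinP.
- by move=> w _ /=; rewrite lee_fin normrX normr_id; case: (le w).
- exact/measurable_EFinP.
- by move=> w _ /=; rewrite lee_fin normrX normr_id; case: (le w).
Qed.

Lemma is_cderive_charfun_deriv n t :
  is_cderive t (charfun_deriv n) (charfun_deriv n.+1 t).
Proof.
(* Any open interval around t would do, as the majorant |X|^(n+1) is the same for all t. *)
have tt : t - 1 < t < t + 1 by apply/andP; split; lra.
split; rewrite /charfun_deriv /cexpectation /= unlock.
- apply: (is_derive_Rintegral
    (h := fun s w => complex.Re (charfun_integrand n s (X w)))
    (h' := fun s w => complex.Re (charfun_integrand n.+1 s (X w))) tt)
    (integrable_abs_moment n.+1).
  + by move=> s _; have [] := integrable_charfun_integrand n s.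
  + by move=> s w _; have [] := is_cderive_charfun_integrand n s (X w).
  + by move=> s w _; have [] := ReIm_charfun_integrand_le n.+1 s (X w).
- apply: (is_derive_Rintegral
    (h := fun s w => complex.Im (charfun_integrand n s (X w)))
    (h' := fun s w => complex.Im (charfun_integrand n.+1 s (X w))) tt)
    (integrable_abs_moment n.+1).
  + by move=> s _; have [] := integrable_charfun_integrand n s.
  + by move=> s w _; have [] := is_cderive_charfun_integrand n s (X w).
  + by move=> s w _; have [] := ReIm_charfun_integrand_le n.+1 s (X w).
Qed.

Lemma charfun_derivE0 : charfun_deriv 0 = charfun P X.
Proof.
apply/funext => t; rewrite /charfun_deriv /charfun /charfun_integrand.
by under eq_fun do rewrite expr0 mul1r.
Qed.

Lemma charfun_deriv0 n :
  charfun_deriv n 0 = 'i%C ^+ n * ((fine 'E_P[fun w => X w ^+ n])%:C)%C.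
Proof.
have E w : charfun_integrand n 0 (X w) = 'i%C ^+ n * ((X w ^+ n)%:C)%C :> R[i].
  by rewrite /charfun_integrand cexp_imE mulr0 cos0 sin0 mulr1 exprMn rmorphXn.
have ix := integrable_moment n.
rewrite /charfun_deriv; under eq_fun do rewrite E.
rewrite /cexpectation unlock.
apply/eqP; rewrite eq_complex ReM ImM /= !mulr0 subr0 add0r.
apply/andP; split; apply/eqP.
- transitivity (\int[P]_w (complex.Re ('i%C ^+ n : R[i]) * X w ^+ n)).
    by apply: eq_Rintegral => w _; rewrite ReM /= mulr0 subr0.
  exact: RintegralZl.
- transitivity (\int[P]_w (complex.Im ('i%C ^+ n : R[i]) * X w ^+ n)).
    by apply: eq_Rintegral => w _; rewrite ImM /= mulr0 add0r.
  exact: RintegralZl.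
Qed.

Lemma moment_fin n :
  'E_P[fun w => (X w ^+ n)%R]%E = (fine 'E_P[fun w => (X w ^+ n)%R])%:E.
Proof.
by rewrite fineK // unlock; exact: integrable_fin_num (integrable_moment n).
Qed.

Lemma moment0 : fine 'E_P[fun w => (X w ^+ 0)%R]%E = 1.
Proof. by under eq_fun do rewrite expr0; rewrite -/(cst 1) expectation_cst. Qed.

End charfun_derivatives.

(** * Derivative of the principal logarithm on the right half-plane *)

Section complex_logarithm.
Context {R : realType}.

Lemma is_derive_modulus (u v : R -> R) (t u' v' : R) :
  is_derive t 1 (u : R -> R^o) u' -> is_derive t 1 (v : R -> R^o) v' -> 0 < u t ->
  is_derive t 1 (fun s => Num.sqrt (u s ^+ 2 + v s ^+ 2) : R^o)
    ((u t * u' + v t * v') / Num.sqrt (u t ^+ 2 + v t ^+ 2)).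
Proof.
move=> du dv u0.
have q0 : 0 < u t ^+ 2 + v t ^+ 2 by rewrite ltr_wpDr ?sqr_ge0 ?exprn_gt0.
have dq : is_derive t 1 (fun s => u s ^+ 2 + v s ^+ 2 : R^o) (2 * (u t * u' + v t * v')).
  by apply: is_derive_eq; rewrite /GRing.scale /=; ring.
apply: (is_derive_eq (is_derive1_comp (f := Num.sqrt)
  (g := fun s => u s ^+ 2 + v s ^+ 2) (is_derive1_sqrt q0) dq)).
have r0 : Num.sqrt (u t ^+ 2 + v t ^+ 2) != 0 by rewrite gt_eqF ?sqrtr_gt0.
by rewrite /=; field.
Qed.

Lemma is_derive_ln_modulus (u v : R -> R) (t u' v' : R) :
  is_derive t 1 (u : R -> R^o) u' -> is_derive t 1 (v : R -> R^o) v' -> 0 < u t ->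
  is_derive t 1 (fun s => ln (Num.sqrt (u s ^+ 2 + v s ^+ 2)) : R^o)
    ((u t * u' + v t * v') / (u t ^+ 2 + v t ^+ 2)).
Proof.
move=> du dv u0.
have q0 : 0 < u t ^+ 2 + v t ^+ 2 by rewrite ltr_wpDr ?sqr_ge0 ?exprn_gt0.
have r0 : 0 < Num.sqrt (u t ^+ 2 + v t ^+ 2) by rewrite sqrtr_gt0.
apply: (is_derive_eq (is_derive1_comp (f := @ln R)
  (g := fun s => Num.sqrt (u s ^+ 2 + v s ^+ 2)) (is_derive1_ln r0)
  (is_derive_modulus du dv u0))).
rewrite -[in RHS](sqr_sqrtr (ltW q0)) /=; field; exact: lt0r_neq0.
Qed.

Lemma is_derive_half_angle (u v : R -> R) (t u' v' : R) :
  is_derive t 1 (u : R -> R^o) u' -> is_derive t 1 (v : R -> R^o) v' -> 0 < u t ->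
  is_derive t 1 (fun s => 2 * atan (v s / (Num.sqrt (u s ^+ 2 + v s ^+ 2) + u s)) : R^o)
    ((u t * v' - v t * u') / (u t ^+ 2 + v t ^+ 2)).
Proof.
move=> du dv u0.
have q0 : 0 < u t ^+ 2 + v t ^+ 2 by rewrite ltr_wpDr ?sqr_ge0 ?exprn_gt0.
have dr := is_derive_modulus du dv u0.
set r := fun s => Num.sqrt (u s ^+ 2 + v s ^+ 2) in dr *.
have rq : r t ^+ 2 = u t ^+ 2 + v t ^+ 2 by rewrite sqr_sqrtr ?ltW.
have r0 : 0 < r t by rewrite sqrtr_gt0.
have n0 : r t + u t != 0 by rewrite gt_eqF ?addr_gt0.
have dru : is_derive t 1 (fun s => r s + u s : R^o) ((u t * u' + v t * v') / r t + u').
  exact: (is_deriveD dr du).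
have dw : is_derive t 1 (fun s => v s / (r s + u s) : R^o)
    ((v' * (r t + u t) - v t * ((u t * u' + v t * v') / r t + u')) / (r t + u t) ^+ 2).
  apply: (is_derive_eq (is_deriveM dv (is_deriveV (f := fun s => r s + u s) n0 dru))).
  by rewrite /GRing.scale /=; field; rewrite n0 gt_eqF.
have da := is_derive1_comp (f := @atan R) (g := fun s => v s / (r s + u s)) (is_derive1_atan _) dw.
apply: (is_derive_eq (is_deriveM (is_derive_cst (2:R) t 1) da)).
rewrite /GRing.scale /= mulr0 addr0 -rq.
have r0' : r t != 0 by rewrite gt_eqF.
(* This identity and the next hold only modulo r^2 = u^2 + v^2. The defect is displayed as a
   multiple of the difference of the two sides and then removed by [rq]. *)
have -> : 1 + (v t / (r t + u t)) ^+ 2 = 2 * r t / (r t + u t).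
  have -> : 1 + (v t / (r t + u t)) ^+ 2 = 2 * r t / (r t + u t) +
    (u t ^+ 2 + v t ^+ 2 - r t ^+ 2) / (r t + u t) ^+ 2 by field.
  by rewrite rq subrr mul0r addr0.
have -> : v' * (r t + u t) - v t * ((u t * u' + v t * v') / r t + u') =
    (r t + u t) * (u t * v' - v t * u') / r t +
    v' * (r t ^+ 2 - (u t ^+ 2 + v t ^+ 2)) / r t by field.
rewrite -rq subrr mulr0 mul0r addr0; field.
by rewrite r0' n0.
Qed.

(** By continuity f stays in the open right half-plane, hence away from the branch cut of [clog]. *)
Lemma near_Re_gt0 (f : R -> R[i]) (t : R) (l : R[i]) :
  is_cderive t f l -> 0 < complex.Re (f t) ->
  \forall s \near t, 0 < complex.Re (f s).
Proof.
move=> [[fr _] _] f0.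
have fc : {for t, continuous (fun s => complex.Re (f s) : R^o)}.
  exact/differentiable_continuous/derivable1_diffP.
exact: (fc _ (lt_nbhsr f0)).
Qed.

Lemma is_cderive_clog (f : R -> R[i]) (t : R) (l : R[i]) :
  is_cderive t f l -> 0 < complex.Re (f t) ->
  is_cderive t (fun s => clog (f s)) (l / f t).
Proof.
move=> [fr fi] f0.
have nE z : Normc.normc z = Num.sqrt (complex.Re z ^+ 2 + complex.Im z ^+ 2) :> R.
  by case: z.
have lE : l / f t =
    ((complex.Re (f t) * complex.Re l + complex.Im (f t) * complex.Im l) /
       (complex.Re (f t) ^+ 2 + complex.Im (f t) ^+ 2) +i*
     ((complex.Re (f t) * complex.Im l - complex.Im (f t) * complex.Re l) /
       (complex.Re (f t) ^+ 2 + complex.Im (f t) ^+ 2)))%C.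
  have := f0; case: (f t) => a b /=; case: l {fr fi} => c e /= a0.
  have q0 : a ^+ 2 + b ^+ 2 != 0 by rewrite gt_eqF // ltr_wpDr ?sqr_ge0 ?exprn_gt0.
  apply/eqP; rewrite eq_complex ReM ImM /=; apply/andP; split; apply/eqP; by field.
rewrite lE; split.
- rewrite [complex.Re (_ +i* _)%C]/=.
  have := is_derive_ln_modulus fr fi f0.
  by congr is_derive; apply/funext => s; rewrite /clog /= nE.
- rewrite [complex.Im (_ +i* _)%C]/=.
  (* The test in [carg] fails wherever the real part is positive, so near t the argument is given by
     the half-angle formula. *)
  apply: near_eq_is_derive (is_derive_half_angle fr fi f0).
  near=> s; rewrite /clog /carg nE /=.
  have s0 : 0 < complex.Re (f s) by near: s; exact: near_Re_gt0 (conj fr fi) f0.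
  by rewrite ltNge ltW.
Unshelve. all: by end_near. Qed.

End complex_logarithm.

(** * Iterated derivatives and the Leibniz rule for f' = f * L' *)

Section smooth.
Context {R : realType} (U : set R).
Context (openU : forall t, U t -> \forall s \near t, U s).

(** Being n times differentiable on U, in existential form: sums and products go through by
    induction without formulas for their higher derivatives. *)
Fixpoint smooth n (f : R -> R[i]) : Prop :=
  if n is n'.+1 then
    exists g, (forall t, U t -> is_cderive t f (g t)) /\ smooth n' g
  else True.

Lemma smoothW n f : smooth n.+1 f -> smooth n f.
Proof.
elim: n f => [//|n IH] f [g [fg sg]].
by exists g; split => //; exact: IH.
Qed.

Lemma smoothD n f g : smooth n f -> smooth n g -> smooth n (fun s => f s + g s).
Proof.
elim: n f g => [//|n IH] f g [f' [df sf]] [g' [dg sg]].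
exists (fun s => f' s + g' s); split; last exact: IH.
by move=> t Ut; apply: is_cderiveD; [exact: df|exact: dg].
Qed.

Lemma smoothM n f g : smooth n f -> smooth n g -> smooth n (fun s => f s * g s).
Proof.
elim: n f g => [//|n IH] f g sf sg.
have [f' [df sf']] := sf; have [g' [dg sg']] := sg.
exists (fun s => f' s * g s + f s * g' s); split.
  by move=> t Ut; apply: is_cderiveM; [exact: df|exact: dg].
by apply: smoothD; apply: IH => //; exact: smoothW.
Qed.

Lemma smooth_seq (F : nat -> R -> R[i]) :
  (forall n t, U t -> is_cderive t (F n) (F n.+1 t)) ->
  forall n k, smooth n (F k).
Proof.
by move=> dF; elim=> [//|n IH] k; exists (F k.+1); split => // t /dF; exact.
Qed.

(** [derive1n] adds a new derivative on the outside, whereas [smooth] peels off the innermost one;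
    this passes between the two. Openness of U allows an equality on U to be differentiated. *)
Lemma derive1n_near (h k : R -> R) :
  (forall t, U t -> derive1 (h : R -> R^o) t = k t) ->
  forall m t, U t -> derive1n m.+1 (h : R -> R^o) t = derive1n m (k : R -> R^o) t.
Proof.
move=> hk; elim=> [|m IH] t Ut; first by rewrite derive1n0 derive1n1 hk.
change (derive1 (derive1n m.+1 (h : R -> R^o)) t =
  derive1 (derive1n m (k : R -> R^o)) t).
rewrite !derive1E; apply: near_eq_derive.
by near=> s; apply: IH; near: s; exact: openU.
Unshelve. all: by end_near. Qed.

Lemma cderive1n_near (f g : R -> R[i]) :
  (forall t, U t -> is_cderive t f (g t)) ->
  forall m t, U t -> cderive1n m.+1 f t = cderive1n m g t.
Proof.
move=> fg m t Ut; rewrite /cderive1n; congr (_ +i* _)%C; apply: derive1n_near => // s Us.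
- by have [? _] := fg s Us; rewrite derive1E derive_val.
- by have [_ ?] := fg s Us; rewrite derive1E derive_val.
Qed.

Lemma cderive1n0 (f : R -> R[i]) : cderive1n 0 f = f.
Proof. by apply/funext => t; rewrite /cderive1n !derive1n0; case: (f t). Qed.

Lemma is_cderive_cderive1n n f : smooth n.+1 f ->
  forall m t, (m <= n)%N -> U t ->
  is_cderive t (cderive1n m f) (cderive1n m.+1 f t).
Proof.
elim: n f => [|n IH] f [g [fg sg]] m t mn Ut; rewrite (cderive1n_near fg _ Ut).
  by move: mn; rewrite leqn0 => /eqP ->; rewrite !cderive1n0; exact: fg.
case: m mn => [|m] mn; first by rewrite !cderive1n0; exact: fg.
apply: near_eq_is_cderive (IH g sg m t mn Ut).
by near=> s; rewrite (cderive1n_near fg) //; near: s; exact: openU.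
Unshelve. all: by end_near. Qed.

(** Induction on n: the formula holds near t, so it can be differentiated there, and the two
    resulting sums merge by Pascal's rule. *)
Lemma leibniz (F L : nat -> R -> R[i]) :
  (forall n t, U t -> is_cderive t (F n) (F n.+1 t)) ->
  (forall n t, U t -> is_cderive t (L n) (L n.+1 t)) ->
  (forall t, U t -> F 1%N t = F 0%N t * L 1%N t) ->
  forall n t, U t ->
    F n.+1 t = \sum_(i < n.+1) 'C(n, i)%:R * F (n - i)%N t * L i.+1 t.
Proof.
move=> dF dL F1; elim=> [|n IH] t Ut; first by rewrite big_ord1 bin0 mul1r F1.
have dS := is_cderive_sum (n := n.+1)
  (f := fun i s => 'C(n, i)%:R * F (n - i)%N s * L i.+1 s) (t := t) (fun i _ =>
  is_cderiveM (is_cderiveZ 'C(n, i)%:R (dF (n - i)%N t Ut)) (dL i.+1 t Ut)).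
have nS : \forall s \near t,
    \sum_(i < n.+1) 'C(n, i)%:R * F (n - i)%N s * L i.+1 s = F n.+1 s.
  by near=> s; rewrite IH //; near: s; exact: openU.
rewrite (is_cderive_unique (dF n.+1 t Ut) (near_eq_is_cderive nS dS)).
rewrite /= big_split /=.
(* The first term of one sum and the last term of the other stay alone; the remaining terms pair up
   with a shift of one and combine through [binS]. *)
rewrite [X in X + _]big_ord_recl [X in _ + X]big_ord_recr /=.
rewrite [RHS]big_ord_recl [X in _ = _ + X]big_ord_recr /= !bin0 !subn0 !binn !subnn.
rewrite !mul1r -!addrA; congr (_ + _); rewrite !addrA; congr (_ + _).
rewrite -big_split /=; apply: eq_bigr => i _; rewrite /bump /= !add1n.
rewrite binS natrD !mulrDl; congr (_ + _).
have -> : (n.+1 - i.+1 = n - i)%N by [].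
by rewrite -subSn // addrC.
Unshelve. all: by end_near. Qed.

End smooth.

(** The derivative is written as a product of [-1], [l] and two copies of the inverse, so that
    [smoothM] applies to it factor by factor in [clog_leibniz]. *)
Lemma is_cderiveV (R : realType) (f : R -> R[i]) (t : R) (l : R[i]) :
  is_cderive t f l -> f t != 0 ->
  is_cderive t (fun s => (f s)^-1) (-1 * (l * ((f t)^-1 * (f t)^-1))).
Proof.
move=> [fr fi] f0.
pose a s := complex.Re (f s); pose b s := complex.Im (f s).
have n0 : a t ^+ 2 + b t ^+ 2 != 0.
  move: f0; rewrite /a /b; case: (f t) => x y /=; apply: contra_neq => /eqP.
  by rewrite paddr_eq0 ?sqr_ge0 // !sqrf_eq0 => /andP[/eqP -> /eqP ->].
have dn : is_derive t 1 (fun s => a s ^+ 2 + b s ^+ 2 : R^o)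
    (2 * (a t * complex.Re l + b t * complex.Im l)).
  by apply: is_derive_eq; rewrite /GRing.scale /= /a /b; ring.
have dV := is_deriveV (f := fun s => a s ^+ 2 + b s ^+ 2) n0 dn.
have fV s : (f s)^-1 = (a s / (a s ^+ 2 + b s ^+ 2) +i* - (b s / (a s ^+ 2 + b s ^+ 2)))%C.
  by rewrite /a /b; case: (f s).
have lE : -1 * (l * ((f t)^-1 * (f t)^-1)) =
   ((complex.Re l * (b t ^+ 2 - a t ^+ 2) - 2 * a t * b t * complex.Im l) /
      (a t ^+ 2 + b t ^+ 2) ^+ 2 +i*
    ((complex.Im l * (b t ^+ 2 - a t ^+ 2) + 2 * a t * b t * complex.Re l) /
      (a t ^+ 2 + b t ^+ 2) ^+ 2))%C.
  rewrite fV; case: l {fr fi dn dV} => x y; apply/eqP; rewrite eq_complex !(ReM, ImM) /=.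
  by apply/andP; split; apply/eqP; field.
rewrite lE; split; under eq_fun do rewrite fV.
- apply: (is_derive_eq (is_deriveM fr dV)).
  by rewrite /GRing.scale /= -/(a t) -/(b t); field.
- apply: (is_derive_eq (is_deriveN (is_deriveM fi dV))).
  by rewrite /GRing.scale /= -/(a t) -/(b t); field.
Qed.

Lemma clog_leibniz (R : realType) (F : nat -> R -> R[i]) :
  (forall n t, is_cderive t (F n) (F n.+1 t)) -> F 0%N 0 = 1 ->
  forall n, F n.+1 0 = \sum_(i < n.+1)
    'C(n, i)%:R * F (n - i)%N 0 * cderive1n i.+1 (fun s => clog (F 0%N s)) 0.
Proof.
move=> dF F0 n.
(* On this open neighbourhood of 0 the function is nonzero and avoids the branch cut. *)
pose U : set R := [set t | 0 < complex.Re (F 0%N t)].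
have openU t : U t -> \forall s \near t, U s by exact: near_Re_gt0.
have U0 : U 0 by rewrite /U /= F0 /= ltr01.
have F0n t : U t -> F 0%N t != 0.
  by rewrite /U /= => F0t; apply: contraTneq F0t => ->; rewrite ltxx.
pose V t := (F 0%N t)^-1.
have sF := smooth_seq (U := U) (fun n t _ => dF n t).
(* Bootstrap: V' = - F' V^2 contains V itself, so smoothness of order k yields order k + 1. *)
have sV k : smooth U k V.
  elim: k => [//|k IH]; exists (fun s => -1 * (F 1%N s * (V s * V s))); split.
    by move=> t Ut; apply: is_cderiveV => //; exact: F0n.
  have s1 : smooth U k (fun=> -1).
    (* The constant -1 heads the sequence of derivatives -1, 0, 0, ... *)
    have := smooth_seq (U := U) (F := fun j _ => if j is 0%N then -1 else 0).
    by move=> /(_ _ k 0%N); apply => -[|j] t _; exact: is_cderive_cst.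
  by apply: smoothM => //; apply: smoothM => //; exact: smoothM.
have dlog t : U t -> is_cderive t (fun s => clog (F 0%N s)) (F 1%N t * V t).
  by move=> Ut; exact: is_cderive_clog.
have slog k : smooth U k.+1 (fun s => clog (F 0%N s)).
  by exists (fun s => F 1%N s * V s); split => //; exact: smoothM.
pose L k := cderive1n k (fun s => clog (F 0%N s)).
have dL k t : U t -> is_cderive t (L k) (L k.+1 t).
  by move=> Ut; exact: (is_cderive_cderive1n openU (slog k)).
apply: (leibniz openU (L := L)) => //.
move=> t Ut; have := dL 0%N t Ut; rewrite {1}/L cderive1n0 => d1.
by rewrite (is_cderive_unique d1 (dlog t Ut)) mulrCA mulfV ?mulr1 ?F0n.
Qed.

(** * Exponential generating series and the expansion of moments in cumulants *)

(** The exponential generating series of [a], cut after degree k; the cut leaves the coefficients of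
    its powers up to degree k unchanged. *)
Definition egf (F : numFieldType) (a : nat -> F) (k : nat) : {poly F} :=
  \poly_(i < k.+1) (a i / i`!%:R).

(** By distributivity each of the j factors picks one degree, so the terms of the power are indexed
    by functions on ['I_j]. *)
Lemma coef_egf_exp (F : numFieldType) (a : nat -> F) k j n :
  ((egf a k) ^+ j)`_n =
  \sum_(f : {ffun 'I_j -> 'I_k.+1} | (\sum_i (f i : nat) == n)%N)
     \prod_i (a (f i) / (f i)`!%:R).
Proof.
rewrite -[j in LHS]card_ord -prodr_const.
under eq_bigr do rewrite /egf poly_def.
rewrite bigA_distr_bigA /= coef_sum [RHS]big_mkcond /=.
apply: eq_bigr => f _.
under eq_bigr do rewrite -mul_polyC.
rewrite big_split /= -rmorph_prod mul_polyC coefZ.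
rewrite (_ : \prod_i 'X^(f i) = 'X^(\sum_i f i)); last first.
  by elim/big_ind2: _ => [|x1 x2 y1 y2 -> ->|//]; rewrite ?expr0 // exprD.
by rewrite coefXn eq_sym; case: eqP => _; rewrite ?mulr1 ?mulr0.
Qed.

(* The recursion says m' = m * c' for the exponential generating series, hence
   m = exp c; modulo 'X^(k.+1) the exponential series may be cut at order k. *)
Lemma moments_of_cumulants (F : numFieldType) (m c : nat -> F) k :
  m 0%N = 1 -> c 0%N = 0 ->
  (forall n, m n.+1 = \sum_(i < n.+1) 'C(n, i)%:R * m (n - i)%N * c i.+1) ->
  m k = k`!%:R * \sum_(j < k.+1) j`!%:R^-1 * ((egf c k) ^+ j)`_k.
Proof.
move=> m0 c0 mS.
set K := egf c k.
have factN0 n : n`!%:R != 0 :> F by rewrite pnatr_eq0 -lt0n fact_gt0.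
have K0 : K`_0 = 0 by rewrite coef_poly c0 mul0r.
pose E : {poly F} := \sum_(j < k.+1) j`!%:R^-1 *: K ^+ j.
have XK : exists q, K = q * 'X.
  have /factor_theorem[q] : root K 0 by apply/rootP; rewrite horner_coef0.
  by rewrite subr0 => ->; exists q.
(* Differentiation lowers the order of the cut exponential by one. As 'X divides K, the defect K^k *
   K' starts in degree k and is invisible in the coefficients compared below. *)
have E' : E^`() = E * K^`() - k`!%:R^-1 *: (K ^+ k * K^`()).
  rewrite /E raddf_sum big_ord_recl /= expr0 derivZ -polyC1 derivC scaler0 add0r.
  rewrite big_ord_recr /= mulrDl -scalerAl addrK big_distrl /=.
  apply: eq_bigr => i _; rewrite derivZ deriv_exp /= -scalerMnr scalerMnl.
  rewrite /bump /= add1n /= -scalerAl mulrC; congr (_ *: _).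
  rewrite factS natrM invfM -mulr_natr mulrAC mulVf ?mul1r ?pnatr_eq0 //.
have coefE' n : (n < k)%N ->
    E`_n.+1 *+ n.+1 = \sum_(i < n.+1) E`_(n - i) * (K`_i.+1 *+ i.+1).
  move=> nk; rewrite -coef_deriv E' coefB coefZ.
  have [q Kq] := XK.
  rewrite [X in _ - _ * X](_ : _ = 0) ?mulr0 ?subr0; last first.
    by rewrite {1}Kq exprMn mulrAC coefMXn nk.
  by rewrite coefMr; apply: eq_bigr => i _; rewrite coef_deriv.
(* By strong induction: comparing coefficients in E' = E * K' gives the recursion [mS] divided by
   factorials. *)
suff H n : (n <= k)%N -> E`_n = m n / n`!%:R.
  have -> : \sum_(j < k.+1) j`!%:R^-1 * (K ^+ j)`_k = E`_k.
    by rewrite coef_sum; apply: eq_bigr => i _; rewrite coefZ.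
  by rewrite H // mulrC divfK.
elim/ltn_ind: n => -[|n] IH nk.
  rewrite m0 fact0 divr1 coef_sum big_ord_recl /= expr0 coefZ coef1 mulr1.
  rewrite fact0 invr1 big1 ?addr0 // => i _; rewrite coefZ exprS.
  by have [q ->] := XK; rewrite -mulrA mulrCA coefXM mulr0.
have nS0 : n.+1%:R != 0 :> F by rewrite pnatr_eq0.
apply: (mulIf nS0); rewrite mulr_natr coefE' // mS.
rewrite -mulrA mulr_suml; apply: eq_bigr => i _.
have ini : (i <= n)%N by rewrite -ltnS.
rewrite IH ?ltnS ?leq_subr //; last exact: leq_trans (leq_subr _ _) (ltnW nk).
rewrite coef_poly ltnS (leq_trans _ nk) ?ltnS //.
rewrite [n.+1`!]factS [i.+1`!]factS -(bin_fact ini) !natrM -mulr_natr.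
have := factN0 i; have := factN0 (n - i)%N.
have b0 : 'C(n, i)%:R != 0 :> F by rewrite pnatr_eq0 -lt0n bin_gt0.
have i0 : i.+1%:R != 0 :> F by rewrite pnatr_eq0.
by move=> h1 h2; field; rewrite !nat1r h1 h2 b0 i0 nS0.
Qed.

(** Equality case of a count: j parts of size at least 2 already use up 2j, which leaves no room for
    a larger part. *)
Lemma sum_ge2_eq2 j (f : 'I_j -> nat) :
  (forall i, 2 <= f i)%N -> (\sum_i f i <= j.*2)%N -> forall i, f i = 2%N.
Proof.
move=> f2 fj i; apply/eqP; rewrite eqn_leq f2 andbT leqNgt; apply/negP => fi.
move: fj; rewrite (bigD1 i) //= leqNgt => /negP; apply.
have : (\sum_(l < j | l != i) 2 <= \sum_(l < j | l != i) f l)%N.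
  by apply: leq_sum => l _; exact: f2.
rewrite sum_nat_const cardC1 card_ord.
move: (\sum_(l < j | l != i) f l)%N (ltn_ord i) fi => s; move: (f i) => t; lia.
Qed.

(** A part equal to 0 or 1 brings a zero factor, which leaves exactly the index set of [coefA]. *)
Lemma egf_exp_ge2 (F : numFieldType) (c : nat -> F) k j :
  c 0%N = 0 -> c 1%N = 0 ->
  k`!%:R * ((egf c k) ^+ j)`_k =
  \sum_(f : {ffun 'I_j -> 'I_k.+1} |
          (\sum_i (f i : nat) == k)%N && [forall i, (2 <= f i)%N])
     (\prod_i c (f i)) * (k`!%:R / \prod_i ((f i)`!)%:R).
Proof.
move=> c0 c1; rewrite coef_egf_exp big_distrr /= [RHS]big_mkcondr /=.
apply: eq_bigr => f _; case: forallP => [_|/forallP].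
  by rewrite big_split /= prodfV mulrCA.
rewrite negb_forall => /existsP[i fi].
rewrite (bigD1 i) //= (_ : c (f i) = 0) ?mul0r ?mulr0 //.
by move: (nat_of_ord (f i)) fi => [|[|]].
Qed.

(** Still an exact identity; absolute values enter only in [moment_diff_bound]. *)
Lemma moments_sub (F : numFieldType) (m mN c : nat -> F) k :
  m 0%N = 1 -> mN 0%N = 1 -> c 0%N = 0 -> c 1%N = 0 -> c 2%N = 1 ->
  (forall n, m n.+1 = \sum_(i < n.+1) 'C(n, i)%:R * m (n - i)%N * c i.+1) ->
  mN 1%N = 0 -> (forall n, mN n.+2 = n.+1%:R * mN n) ->
  (3 <= k)%N ->
  m k - mN k = \sum_(1 <= j < (uphalf (k - 2)).+1) (j`!%:R)^-1 *
    \sum_(f : {ffun 'I_j -> 'I_k.+1} |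
            (\sum_i (f i : nat) == k)%N && [forall i, (2 <= f i)%N])
       (\prod_i c (f i)) * (k`!%:R / \prod_i ((f i)`!)%:R).
Proof.
move=> m0 mN0 c0 c1 c2 mS mN1 mNSS k3.
(* The cumulants of the normal law. In their recursion only the term i = 1 survives, which is the
   two-step recursion of [mN]. *)
pose cN n : F := (n == 2%N)%:R.
have mNS n : mN n.+1 = \sum_(i < n.+1) 'C(n, i)%:R * mN (n - i)%N * cN i.+1.
  case: n => [|n]; first by rewrite big_ord1 mN1 /cN mulr0.
  rewrite 2!big_ord_recl /cN /= mulr0 add0r mulr1 bin1 subSS subn0 -mNSS.
  by rewrite big1 ?addr0 // => i _; rewrite /= mulr0.
rewrite (moments_of_cumulants _ m0 c0 mS).
rewrite (moments_of_cumulants (c := cN) _ mN0 erefl mNS).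
rewrite -mulrBr -sumrB mulr_sumr.
under eq_bigr => j _.
  rewrite -mulrBr mulrCA mulrBr egf_exp_ge2 // egf_exp_ge2 // -sumrB.
  under eq_bigr do rewrite -mulrBl.
  over.
pose T j : F := j`!%:R^-1 * \sum_(f : {ffun 'I_j -> 'I_k.+1} |
            (\sum_i (f i : nat) == k)%N && [forall i, (2 <= f i)%N])
       (\prod_i c (f i) - \prod_i cN (f i)) * (k`!%:R / \prod_i ((f i)`!)%:R).
rewrite /= -(big_mkord xpredT T) (big_cat_nat (n := 1)) //= big_nat1.
(* The term j = 0 vanishes: an empty tuple has sum 0, not k. *)
rewrite {1}/T big1 ?mulr0 ?add0r; last first.
  by move=> f /andP[/eqP]; rewrite big_ord0 => k0; rewrite -k0 in k3.
have uk : (1 <= (uphalf (k - 2)).+1 <= k.+1)%N by lia.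
rewrite (big_cat_nat (n := (uphalf (k - 2)).+1)) //=.
(* Here 2j >= k, so all parts equal 2, where [c] and [cN] agree. *)
rewrite [X in _ + X]big_nat [X in _ + X]big1 ?addr0; last first.
  move=> j jk; rewrite /T big1 ?mulr0 // => f /andP[/eqP fk /forallP f2].
  have f2p : forall i, f i = 2%N :> nat.
    by apply: (@sum_ge2_eq2 j (fun i => f i : nat)) => //; rewrite fk; lia.
  rewrite (eq_bigr (fun i => cN (f i))) ?subrr ?mul0r // => i _.
  by rewrite /cN f2p.
rewrite big_nat [RHS]big_nat; apply: eq_bigr => j jk; rewrite /T.
congr (_ * _); apply: eq_bigr => f /andP[/eqP fk /forallP f2].
(* Here 2j < k, so some part differs from 2 and [cN] vanishes on it. *)
suff -> : \prod_i cN (f i) = 0 by rewrite subr0.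
have [i fi] : exists i, f i != 2%N :> nat.
  apply/existsP; apply: contraTT isT; rewrite negb_exists => /forallP f2'.
  have : (\sum_i f i = j * 2)%N.
    rewrite (eq_bigr (fun=> 2%N)); last by move=> i _; apply/eqP/negbNE/f2'.
    by rewrite sum_nat_const card_ord.
  by rewrite fk; lia.
by rewrite (bigD1 i) //= /cN (negbTE fi) mul0r.
Qed.

(** * Moments of the standard normal law *)

Section normal_moments.
Context d (T : measurableType d) (R : realType) (Q : probability T R).
Context (N : {RV Q >-> R}) (hN : standard_normal N).

Lemma ge0_expectation_normal (g : R -> R) :
  measurable_fun setT g -> (forall x, 0 <= g x) ->
  (\int[Q]_w (g (N w))%:E =
   \int[lebesgue_measure]_x (g x * normal_pdf 0 1 x)%:E)%E.
Proof.
move=> mg g0.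
(* [normal_prob] lives on [measurableTypeR R], whose display differs from that
   of the codomain of [N]; [NR] is [N] seen with values there. *)
have mEg : measurable_fun setT (EFin \o g : measurableTypeR R -> \bar R).
  exact/measurable_EFinP.
have g0' x : (0 <= (EFin \o g) x)%E by rewrite lee_fin.
have mN : measurable_fun setT (N : T -> measurableTypeR R).
  by have h : measurable_fun setT N by []; move=> mT Y mY; exact: h.
pose NR : {mfun T >-> measurableTypeR R} :=
  HB.pack (N : T -> measurableTypeR R) (isMeasurableFun.Build _ _ _ _ _ mN).
transitivity (\int[distribution Q NR]_x (EFin \o g) x)%E.
  by rewrite ge0_integral_distribution.
rewrite [LHS](eq_measure_integral (normal_prob 0 1)); last first.
  by move=> A mA _; exact: hN.
have dom := normal_prob_dominates (0 : R) 1.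
rewrite -(Radon_Nikodym_SigmaFinite.change_of_variables dom g0') //.
apply: ae_eq_integral => //.
- apply: emeasurable_funM => //.
  exact: measurable_int (Radon_Nikodym_SigmaFinite.f_integrable dom).
- apply/measurable_EFinP; apply: measurable_funM => //; exact: measurable_normal_pdf.
(* Uniqueness of densities: the Radon-Nikodym derivative and [normal_pdf] have the same integral
   over every measurable set, hence agree almost everywhere. *)
- under [X in ae_eq _ _ _ X]eq_fun do rewrite EFinM.
  apply: ae_eqe_mul2l; apply: integral_ae_eq => //.
  + exact: Radon_Nikodym_SigmaFinite.f_integrable.
  + by apply/measurable_EFinP; exact: measurable_normal_pdf.
  + by move=> E _ mE; rewrite -Radon_Nikodym_SigmaFinite.f_integral.
Qed.

(* Completing the square turns the density of N(0, 1) tilted by exp (t x) into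
   the density of N(t, 1). *)
Lemma normal_mgf (t : R) :
  (\int[Q]_w (expR (t * N w))%:E = (expR (t ^+ 2 / 2))%:E)%E.
Proof.
have mt : measurable_fun setT (fun x : R => expR (t * x)).
  by apply: measurableT_comp => //; apply: measurable_funM.
rewrite (ge0_expectation_normal mt); last by move=> x; exact: expR_ge0.
transitivity (\int[lebesgue_measure]_x
    ((expR (t ^+ 2 / 2))%:E * (normal_pdf t 1 x)%:E))%E.
  apply: eq_integral => x _; rewrite -EFinM; congr EFin.
  rewrite !normal_pdfE ?oner_neq0 // /normal_fun mulrCA [RHS]mulrCA.
  congr (_ * _); rewrite -!expRD; congr expR; rewrite expr1n; by field.
have := integralZl measurableT (integrable_normal_pdf t 1) (expR (t ^+ 2 / 2)).
by rewrite integral_normal_pdf mule1.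
Qed.

Lemma integrable_expR_normal (t : R) :
  Q.-integrable setT (EFin \o (fun w => expR (t * N w))).
Proof.
apply/integrableP; split.
  by apply/measurable_EFinP; apply: measurableT_comp => //; exact: measurable_funM.
under eq_integral do rewrite /= ger0_norm ?expR_ge0 //.
by rewrite normal_mgf ltry.
Qed.

(** Majorant for |t| < 1: |x|^n <= n! exp|x| and exp(tx) <= exp|x|, and exp(2|x|) is at most exp(2x)
    + exp(-2x), which is integrable by [normal_mgf]. *)
Let G n (w : T) : R := n`!%:R * (expR (2 * N w) + expR (- 2 * N w)).

Let integrable_G n : Q.-integrable setT (EFin \o G n).
Proof.
have := integrableZl measurableT n`!%:R (integrableD measurableT
  (integrable_expR_normal 2) (integrable_expR_normal (- 2))).
exact: eq_integrable.
Qed.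

Let tilted_moment_le_G n (t : R) w : -1 < t < 1 -> `|N w ^+ n * expR (t * N w)| <= G n w.
Proof.
move=> /andP[t1 t2]; rewrite normrM normrX (ger0_norm (expR_ge0 _)) /G.
have h1 : `|N w| ^+ n <= n`!%:R * expR `|N w|.
  case: n => [|n]; first by rewrite expr0 fact0 mul1r -[leLHS]expR0 ler_expR.
  rewrite mulrC -ler_pdivrMr ?ltr0n ?fact_gt0 //.
  by apply: le_trans (expR_ge1Dxn n (normr_ge0 (N w))); rewrite lerDr.
have h2 : expR (t * N w) <= expR `|N w|.
  rewrite ler_expR; apply: le_trans (ler_norm _) _; rewrite normrM ler_piMl //.
  by rewrite ler_norml; apply/andP; split; exact: ltW.
apply: le_trans (ler_pM _ (expR_ge0 _) h1 h2) _; first by rewrite exprn_ge0.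
rewrite -mulrA ler_pM2l ?ltr0n ?fact_gt0 // -expRD.
have [N0|N0] := ger0P (N w).
- by rewrite (_ : N w + N w = 2 * N w) ?lerDl ?expR_ge0 //; ring.
- by rewrite (_ : - N w - N w = - 2 * N w) ?lerDr ?expR_ge0 //; ring.
Qed.

(** The n-th derivative of the moment generating function; its value at 0 is the n-th moment. *)
Let M n (t : R) : R := (\int[Q]_w (N w ^+ n * expR (t * N w)))%R.

Let integrable_tilted n (t : R) : -1 < t < 1 ->
  Q.-integrable setT (EFin \o (fun w => N w ^+ n * expR (t * N w))).
Proof.
move=> t1; apply: (le_integrable _ _ _ (integrable_G n)) => //.
  apply/measurable_EFinP; apply: measurable_funM.
    exact: measurable_funX.
  by apply: measurableT_comp => //; exact: measurable_funM.
move=> w _ /=; rewrite lee_fin; apply: le_trans (tilted_moment_le_G n w t1) _.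
exact: ler_norm.
Qed.

Let is_derive_M n (t : R) : -1 < t < 1 -> is_derive t 1 (M n : R -> R^o) (M n.+1 t).
Proof.
move=> t1.
apply: (is_derive_Rintegral (h := fun s w => N w ^+ n * expR (s * N w))
  (h' := fun s w => N w ^+ n.+1 * expR (s * N w)) t1 _ _ _ (integrable_G n.+1)).
- by move=> s s1; exact: integrable_tilted.
- move=> s w _.
  have ds : is_derive s 1 ( *%R^~ (N w) : R -> R^o) (N w).
    by apply: is_derive_eq; rewrite /GRing.scale /=; ring.
  have de := is_derive1_comp (f := @expR R) (g := *%R^~ (N w)) (is_derive_expR _) ds.
  apply: (is_derive_eq (is_deriveZ (N w ^+ n) de)).
  by rewrite /GRing.scale /= exprSr; ring.
- by move=> s w s1; exact: tilted_moment_le_G.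
Qed.

Let near_itv (t : R) : -1 < t < 1 -> \forall s \near t, -1 < s < 1.
Proof.
move=> /andP[t1 t2]; near=> s; apply/andP; split.
  by near: s; exact: lt_nbhsr.
by near: s; exact: lt_nbhsl.
Unshelve. all: by end_near. Qed.

Let M0E (t : R) : M 0 t = expR (t ^+ 2 / 2).
Proof.
rewrite /M /Rintegral -[RHS]/(fine (expR _)%:E) -normal_mgf; congr fine.
by apply: eq_integral => w _; rewrite expr0 mul1r.
Qed.

Let M1E (t : R) : -1 < t < 1 -> M 1 t = t * M 0 t.
Proof.
move=> t1; have [_ <-] := is_derive_M 0 t1.
have dg : is_derive t 1 (fun s => s ^+ 2 / 2 : R^o) t.
  by apply: is_derive_eq; rewrite /GRing.scale /=; field.
have := is_derive1_comp (f := @expR R) (g := fun s => s ^+ 2 / 2) (is_derive_expR _) dg.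
move=> [_]; rewrite M0E [RHS]mulrC => <-; congr ('D_1 _ t).
by apply/funext => s; rewrite M0E.
Qed.

(** Successive derivatives of [M1E]. The identity is kept on the whole interval because its value at
    0 alone could not be differentiated. *)
Let MSS n (t : R) : -1 < t < 1 -> M n.+2 t = t * M n.+1 t + n.+1%:R * M n t.
Proof.
elim: n t => [|n IH] t t1.
- have d0 := is_derive_M 0 t1.
  have dR : is_derive t 1 (fun s => s * M 0 s : R^o) (t * M 1 t + 1 * M 0 t).
    apply: (is_derive_eq (is_deriveM (is_derive_id t (1 : R)) d0)).
    by rewrite /GRing.scale /= mulr1 mul1r.
  have [_ <-] := is_derive_M 1 t1; have [_ <-] := dR.
  apply: near_eq_derive; near=> s; apply: M1E; near: s; exact: near_itv.
- have d0 := is_derive_M n t1; have d1 := is_derive_M n.+1 t1.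
  have dR : is_derive t 1 (fun s => s * M n.+1 s + n.+1%:R * M n s : R^o)
      (t * M n.+2 t + n.+2%:R * M n.+1 t).
    apply: (is_derive_eq (is_deriveD (is_deriveM (is_derive_id t (1 : R)) d1)
      (is_deriveZ (n.+1%:R : R) d0))).
    by rewrite /GRing.scale /= -[n.+2]addn1 natrD; ring.
  have [_ <-] := is_derive_M n.+2 t1; have [_ <-] := dR.
  apply: near_eq_derive; near=> s; apply: IH; near: s; exact: near_itv.
Unshelve. all: by end_near. Qed.

Let t0 : -1 < (0 : R) < 1. Proof. by rewrite ltrN10 ltr01. Qed.

Let momentE n : 'E_Q[fun w => (N w ^+ n)%R]%E = (M n 0)%:E.
Proof.
rewrite unlock /M /Rintegral fineK; last first.
  exact: integrable_fin_num (integrable_tilted n t0).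
by apply: eq_integral => w _; rewrite mul0r expR0 mulr1.
Qed.

Lemma normal_moments : exists mN : nat -> R,
  [/\ forall n, 'E_Q[fun w => (N w ^+ n)%R]%E = (mN n)%:E,
      mN 0%N = 1, mN 1%N = 0 & forall n, mN n.+2 = n.+1%:R * mN n].
Proof.
exists (M ^~ 0); split; first exact: momentE.
- by rewrite M0E expr0n /= mul0r expR0.
- by rewrite M1E // mul0r.
- by move=> n; rewrite MSS // mul0r add0r.
Qed.

End normal_moments.

(** * From cumulant bounds to moment bounds *)

(** This is [clog_leibniz] for [charfun] with the powers of i removed: the k-th moment carries i^k,
    the j-th cumulant i^j, and the exponents in each term add up to n + 1. *)
Lemma moments_cumulants d (T : measurableType d) (R : realType)
    (P : probability T R) (X : {RV P >-> R}) (hX : has_abs_moments P X) n :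
  let m k := ((fine 'E_P[fun w => (X w ^+ k)%R])%:C)%C in
  m n.+1 = \sum_(i < n.+1) 'C(n, i)%:R * m (n - i)%N * cumulant P X i.+1.
Proof.
move=> m.
have mE k : charfun_deriv X k 0 = 'i%C ^+ k * m k by exact: charfun_deriv0.
have i0 : ('i%C : R[i]) != 0 by rewrite eq_complex /= oner_eq0 andbF.
have cE j : cderive1n j (fun s => clog (charfun P X s)) 0 = 'i%C ^+ j * cumulant P X j.
  rewrite /cumulant mulrA -exprMn mulrN -expr2 sqr_i opprK expr1n mul1r //.
apply: (mulfI (expf_neq0 n.+1 i0)); rewrite -mE.
rewrite (clog_leibniz (is_cderive_charfun_deriv hX)); last first.
  by rewrite mE /m moment0 expr0 mulr1.
rewrite mulr_sumr; apply: eq_bigr => i _.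
rewrite charfun_derivE0 cE mE.
have -> : ('i%C : R[i]) ^+ n.+1 = 'i%C ^+ (n - i) * 'i%C ^+ i.+1.
  by rewrite -exprD addnS subnK // -ltnS.
by ring.
Qed.

Lemma normC_real (R : realType) (x : R) : `|(x%:C)%C| = (`|x|%:C)%C :> R[i].
Proof. by rewrite normc_def /= expr0n addr0 sqrtr_sqr. Qed.

Lemma normCE (R : realType) (z : R[i]) : `|z| = ((Normc.normc z)%:C)%C.
Proof. by rewrite normc_def; case: z. Qed.

Lemma moment_diff_bound d (T : measurableType d) (R : realType)
    (P : probability T R) (X : {RV P >-> R}) d' (T' : measurableType d')
    (Q : probability T' R) (N : {RV Q >-> R}) (C : nat -> R -> R) (gamma Delta : R) k :
  has_abs_moments P X -> 'E_P[X]%E = 0%E -> 'V_P[X]%E = 1%E -> 0 < Delta ->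
  (forall j, (3 <= j)%N -> Normc.normc (cumulant P X j) <= C j gamma / Delta ^+ (j - 2)) ->
  standard_normal N -> (3 <= k)%N ->
  (`| 'E_P[fun w => (X w ^+ k)%R] - 'E_Q[fun w => (N w ^+ k)%R] |
    <= (\sum_(1 <= j < (uphalf (k - 2)).+1)
               coefA C gamma j k / Delta ^+ (k - 2 * j))%R%:E)%E.
Proof.
move=> hX EX VX D0 hC hN k3.
have [mN [EN mN0 mN1 mNSS]] := normal_moments hN.
pose m k := fine 'E_P[fun w => (X w ^+ k)%R].
rewrite EN (moment_fin hX) -/(m k) -EFinB abse_EFin lee_fin.
have m0 : m 0%N = 1 by exact: moment0.
have m1 : m 1%N = 0.
  by rewrite /m; under eq_fun do rewrite expr1; rewrite EX.
have m2 : m 2%N = 1.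
  move: VX; rewrite /variance unlock EX /= /m => VX.
  rewrite -[RHS]/(fine 1%E) -VX; congr (fine 'E_P[_]).
  by apply/funext => w; rewrite mulrfctE /= subr0 expr2.
have rec n : ((m n.+1)%:C)%C = \sum_(i < n.+1)
    'C(n, i)%:R * ((m (n - i)%N)%:C)%C * cumulant P X i.+1.
  exact: moments_cumulants.
(* The recursion starts at cumulants of order 1, so the value at 0 is free to be set to 0. The
   recursion at n = 0 and n = 1, with mean 0 and variance 1, then yields [c1] and [c2]. *)
pose c n : R[i] := if n is 0%N then 0 else cumulant P X n.
have c1 : c 1%N = 0.
  have := rec 0%N; rewrite big_ord1 /= -/(m 1%N) -/(m 0%N) m0 m1.
  by rewrite !mul1r => <-.
have c2 : c 2%N = 1.
  have := rec 1%N; rewrite big_ord_recl big_ord1 /= -/(m 2%N) -/(m 1%N) -/(m 0%N).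
  by rewrite m0 m1 m2 mulr0 mul0r add0r !mul1r => <-.
have mdiff := moments_sub (m := fun n => ((m n)%:C)%C) (mN := fun n => ((mN n)%:C)%C)
  (c := c) (k := k) _ _ erefl c1 c2 rec _ _ k3.
rewrite /= m0 mN0 mN1 in mdiff.
have {}mdiff := mdiff erefl erefl erefl _.
(* The estimate is moved to [R[i]], where the cumulants live. *)
rewrite -lecR -normC_real rmorphB /= mdiff; last first.
  by move=> n; rewrite mNSS rmorphM /= rmorph_nat.
rewrite rmorph_sum /=; apply: le_trans (ler_norm_sum _ _ _) _.
rewrite [leLHS]big_nat [leRHS]big_nat; apply: ler_sum => j jk.
rewrite /coefA -mulrA normrM rmorphM /= fmorphV rmorph_nat.
rewrite normfV normr_nat ler_wpM2l ?invr_ge0 ?ler0n //.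
rewrite mulr_suml rmorph_sum /=; apply: le_trans (ler_norm_sum _ _ _) _.
apply: ler_sum => f /andP[/eqP fk /forallP f2].
rewrite mulrAC rmorphM /= normrM.
have -> : `|(k`!%:R / \prod_i ((f i)`!)%:R : R[i])| =
    ((k`!%:R / \prod_i ((f i)`!)%:R)%:C)%C.
  rewrite ger0_norm; last by rewrite divr_ge0 ?ler0n // prodr_ge0.
  rewrite rmorphM fmorphV /= rmorph_nat rmorph_prod; congr (_ / _).
  by apply: eq_bigr => i _; rewrite rmorph_nat.
apply: ler_wpM2r; first by rewrite ler0c divr_ge0 ?ler0n // prodr_ge0.
(* The power of Delta is shared out among the parts; the truncated subtractions are exact because
   every part is at least 2. *)
have -> : Delta ^+ (k - 2 * j) = \prod_i Delta ^+ (f i - 2).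
  rewrite prodrXr; congr (_ ^+ _).
  rewrite sumnB; last by move=> i _; exact: f2.
  by rewrite fk sum_nat_const card_ord mulnC.
rewrite -prodf_div normr_prod rmorph_prod; apply: ler_prod => i _.
rewrite normr_ge0 normCE lecR /=.
(* A part 2 contributes the cumulant 1, matched by [cumC] and Delta^0; larger parts use the assumed
   bound. *)
have := f2 i; case E : (nat_of_ord (f i)) => [|[|[|l]]] // _.
  by rewrite c2 Normc.normc1 /cumC subnn expr0 divr1.
by rewrite /cumC /= hC.
Qed.

(** * Rates in Delta for even and odd moments *)

Lemma normal_odd_moment d (T : measurableType d) (R : realType)
    (Q : probability T R) (N : {RV Q >-> R}) k :
  standard_normal N -> odd k -> 'E_Q[fun w => (N w ^+ k)%R]%E = 0%E.
Proof.
move=> /normal_moments[mN [-> _ mN1 mNSS]] kodd; congr EFin.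
rewrite -(odd_double_half k) kodd add1n.
by elim: (k./2) => [//|l IH]; rewrite doubleS mNSS IH mulr0.
Qed.

(* [M] stands for an upper bound of 1 / Delta. The truncated subtraction is exact
   in the sums below: 2 * j <= k - 2 for even k and 2 * j <= k - 1 for odd k. *)
Definition coefA_bound (R : realType) (C : nat -> R -> R) (k : nat) (gamma : R)
    (p : nat) (M : R) : R :=
  \sum_(1 <= j < (uphalf (k - 2)).+1) `|coefA C gamma j k| * M ^+ (k - 2 * j - p).

(** The smallest exponent k - 2j in the sum is 2 for even k and 1 for odd k. So Delta^-p factors out
    of every term, and the remaining powers of 1 / Delta are at most those of M. *)
Lemma le_coefA_bound (R : realType) (C : nat -> R -> R) k (gamma Delta M : R) p :
  0 < Delta -> Delta^-1 <= M -> (3 <= k)%N -> (p <= 2 - odd k)%N ->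
  \sum_(1 <= j < (uphalf (k - 2)).+1) coefA C gamma j k / Delta ^+ (k - 2 * j)
    <= coefA_bound C k gamma p M / Delta ^+ p.
Proof.
move=> D0 DM k3 pk; rewrite /coefA_bound mulr_suml big_nat [leRHS]big_nat.
apply: ler_sum => j jk.
apply: le_trans (ler_norm _) _; rewrite normrM -mulrA ler_wpM2l //.
rewrite normfV normrX (gtr0_norm D0) -!exprVn.
have -> : (k - 2 * j = (k - 2 * j - p) + p)%N by lia.
rewrite exprD addnK ler_wpM2r ?exprn_ge0 ?invr_ge0 ?(ltW D0) //.
by rewrite lerXn2r // nnegrE ?invr_ge0 ?(ltW D0) // (le_trans _ DM) // invr_ge0 ltW.
Qed.

Lemma cvgy_inv_bounded (R : realType) (Delta : nat -> R) :
  (forall n, 0 < Delta n) -> Delta @ \oo --> +oo ->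
  exists M, forall n, (Delta n)^-1 <= M.
Proof.
move=> D0 /cvgryPge/(_ 1)[n0 _ n0D].
have S0 n : 0 <= \sum_(i < n) (Delta i)^-1.
  by apply: sumr_ge0 => i _; rewrite invr_ge0 ltW.
(* The 1 covers all n from n0 on; the sum covers each of the finitely many earlier ones. *)
exists (1 + \sum_(i < n0) (Delta i)^-1) => n.
have [nn0|n0n] := ltnP n n0.
  rewrite (bigD1 (Ordinal nn0)) //= addrCA lerDl addr_ge0 //.
  by apply: sumr_ge0 => i _; rewrite invr_ge0 ltW.
apply: (@le_trans _ _ 1); last by rewrite lerDl.
by rewrite invf_le1 //; exact: n0D.
Qed.

(* uphalf (k - 2) is the ceiling of (k - 2) / 2 = k / 2 - 1. *)
Theorem theorem1p1 (R : realType) (C : nat -> R -> R) :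
  exists (C1 C2 : nat -> R -> R) (K1 K2 : nat -> R -> (nat -> R) -> R),
  forall (gamma : R) (hgamma : 0 <= gamma)
    (d : nat -> measure_display) (T : forall n, measurableType (d n))
    (P : forall n, probability (T n) R) (Z : forall n, {RV (P n) >-> R})
    (Delta : nat -> R)
    (d' : measure_display) (T' : measurableType d')
    (Q : probability T' R) (N : {RV Q >-> R})
    (hmoments : forall n, has_abs_moments (P n) (Z n))
    (hcentered : forall n, 'E_(P n)[Z n]%E = 0%E)
    (hvariance : forall n, 'V_(P n)[Z n]%E = 1%E)
    (hDelta : forall n, 0 < Delta n)
    (hcumulants : forall n j, (3 <= j)%N ->
       Normc.normc (cumulant (P n) (Z n) j)
         <= C j gamma / Delta n ^+ (j - 2))
    (hN : standard_normal N),
  [/\ (forall n k, (3 <= k)%N ->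
        (`| 'E_(P n)[fun w => (Z n w ^+ k)%R]
            - 'E_Q[fun w => (N w ^+ k)%R] |
         <= (\sum_(1 <= j < (uphalf (k - 2)).+1)
               coefA C gamma j k / Delta n ^+ (k - 2 * j))%R%:E)%E),
      (Delta @ \oo --> +oo ->
       forall k, (3 <= k)%N -> ~~ odd k ->
        (\forall n \near \oo,
          (`| 'E_(P n)[fun w => (Z n w ^+ k)%R]
              - 'E_Q[fun w => (N w ^+ k)%R] |
           <= (C1 k gamma / Delta n ^+ 2)%R%:E)%E) /\
        (forall n,
          (`| 'E_(P n)[fun w => (Z n w ^+ k)%R]
              - 'E_Q[fun w => (N w ^+ k)%R] |
           <= (K1 k gamma Delta / Delta n ^+ 2)%R%:E)%E)) &
      (Delta @ \oo --> +oo ->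
       forall k, (3 <= k)%N -> odd k ->
        (\forall n \near \oo,
          (`| 'E_(P n)[fun w => (Z n w ^+ k)%R] |
           <= (C2 k gamma / Delta n)%R%:E)%E) /\
        (forall n,
          (`| 'E_(P n)[fun w => (Z n w ^+ k)%R] |
           <= (K2 k gamma Delta / Delta n)%R%:E)%E))].
Proof.
(* The default value 0 of [xget] is never reached: 1 / Delta is bounded when Delta
   tends to infinity. *)
pose Minv (Delta : nat -> R) := xget 0 [set M | forall n, (Delta n)^-1 <= M].
(* For large n the bound 1 / Delta <= 1 gives constants free of Delta. For all n at once the bound
   on 1 / Delta, and with it the constant, depends on the sequence. *)
exists (fun k gamma => coefA_bound C k gamma 2 1),
  (fun k gamma => coefA_bound C k gamma 1 1),
  (fun k gamma Delta => coefA_bound C k gamma 2 (Minv Delta)),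
  (fun k gamma Delta => coefA_bound C k gamma 1 (Minv Delta)).
move=> gamma _ d T P Z Delta d' T' Q N hZ EZ VZ D0 hC hN.
have main n k : (3 <= k)%N -> _ := @moment_diff_bound _ _ _ _ _ _ _ _ _ C gamma _ k
  (hZ n) (EZ n) (VZ n) (D0 n) (hC n) hN.
have MinvP : Delta @ \oo --> +oo -> forall n, (Delta n)^-1 <= Minv Delta.
  move=> Dy; have [M DM] := cvgy_inv_bounded D0 Dy.
  exact: (@xgetI _ 0 [set M | forall n, (Delta n)^-1 <= M] M DM).
have near1 : Delta @ \oo --> +oo -> \forall n \near \oo, (Delta n)^-1 <= 1.
  move=> /cvgryPge/(_ 1) D1; near=> n.
  by rewrite invf_le1 //; near: n.
have bound n k p M : (3 <= k)%N -> (p <= 2 - odd k)%N -> (Delta n)^-1 <= M ->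
    (`| 'E_(P n)[fun w => (Z n w ^+ k)%R] - 'E_Q[fun w => (N w ^+ k)%R] |
     <= (coefA_bound C k gamma p M / Delta n ^+ p)%R%:E)%E.
  move=> k3 pk DM; apply: le_trans (main n k k3) _.
  by rewrite lee_fin; exact: le_coefA_bound.
split=> [|Dy k k3 ke|Dy k k3 ko]; first exact: main.
- have pk : (2 <= 2 - odd k)%N by rewrite (negbTE ke).
  split=> [|n]; last exact: bound (MinvP Dy n).
  near=> n; apply: bound => //; near: n; exact: near1.
- have pk : (1 <= 2 - odd k)%N by rewrite ko.
  have E n M : (Delta n)^-1 <= M -> (`| 'E_(P n)[fun w => (Z n w ^+ k)%R] |
       <= (coefA_bound C k gamma 1 M / Delta n)%R%:E)%E.
    (* As the odd normal moment is 0, the difference is the moment of [Z n] itself. *)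
    move=> DM; have := bound n k 1%N M k3 pk DM.
    by rewrite (normal_odd_moment hN ko) sube0.
  split=> [|n]; last exact: E (MinvP Dy n).
  near=> n; apply: E; near: n; exact: near1.
Unshelve. all: by end_near. Qed.
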